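(* Let $m\geq 0$ and $k\geq \max(m+2,3)$ be integers, let $S=\{0,1,\dots,m\}$, let $G=J_S(3k-2m-1,k)$, and let $C$ be the set of vertices of $G$ containing $\{1,\dots,k-1\}$ (a switching set of $G$). If $CM$ is the graph obtained from $G$ by Godsil–McKay switching with respect to $C$, then $G$ and $CM$ are not isomorphic.
   Context: For integers $n\geq k\geq 2$ and $S\subseteq\{0,1,\dots,k-1\}$, $J_S(n,k)$ is the graph whose vertices are the $k$-subsets of $[n]=\{1,\dots,n\}$, two $k$-subsets $A,B$ being adjacent if $|A\cap B|\in S$. A subset $C$ of the vertex set of a graph $G$ is a switching set if any two vertices of $C$ have the same number of neighbours in $C$ and every vertex outside $C$ is adjacent to $0$, $|C|/2$ or $|C|$ vertices of $C$. Godsil–McKay switching with respect to $C$: for every vertex $u\notin C$ adjacent to exactly $|C|/2$ vertices of $C$, delete the $|C|/2$ edges between $u$ and $C$ and join $u$ to the other $|C|/2$ vertices of $C$; all other adjacencies are unchanged. *)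

(* Defs.v *)
From mathcomp Require Import all_boot.

Set Implicit Arguments.
Unset Strict Implicit.
Unset Printing Implicit Defensive.

Record sgraph := SGraph {
  vertex :> finType;
  adj : rel vertex;
  adj_sym : symmetric adj;
  adj_irr : irreflexive adj }.

Definition isomorphic (G H : sgraph) : Prop :=
  exists2 f : G -> H,
    bijective f & forall u v : G, adj (f u) (f v) = adj u v.

Definition nbrs_in (G : sgraph) (C : {set G}) (u : G) : {set G} :=
  [set v in C | adj u v].

(* [|C|/2] is rendered by doubling, so that it is not rounded when [|C|] is
   odd. *)
Definition switching_set (G : sgraph) (C : {set G}) : Prop :=
  {in C &, forall u v, #|nbrs_in C u| = #|nbrs_in C v|} /\
  (forall u, u \notin C ->
     [\/ #|nbrs_in C u| = 0, (#|nbrs_in C u|).*2 = #|C|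
       | #|nbrs_in C u| = #|C|]).

Section Switching.
Variables (G : sgraph) (C : {set G}).

Definition toggled (u v : G) : bool :=
  [&& u \notin C, v \in C & (#|nbrs_in C u|).*2 == #|C|].

(* [(+)] is exclusive or: the adjacency of [u] and [v] is reversed exactly when
   one of them lies in [C] and the other is outside and has [|C|/2] neighbours
   in [C]. *)
Definition switch_adj (u v : G) : bool :=
  adj u v (+) (toggled u v || toggled v u).

Lemma switch_adj_sym : symmetric switch_adj.
Proof. by move=> u v; rewrite /switch_adj adj_sym orbC. Qed.

Lemma switch_adj_irr : irreflexive switch_adj.
Proof.
by move=> u; rewrite /switch_adj adj_irr /toggled orbb andbA andNb.
Qed.

Definition GM_switch : sgraph := SGraph switch_adj_sym switch_adj_irr.

End Switching.

Section GeneralizedJohnson.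
Variables (n k : nat) (S : {set 'I_k}).

(* The ground set is ['I_n] = {0, ..., n-1}: the element [i] of {1, ..., n} is
   represented by [i - 1]. *)
Definition ksubset : finType := {A : {set 'I_n} | #|A| == k}.

Definition johnson_adj (A B : ksubset) : bool :=
  [exists s in S, #|val A :&: val B| == s].

Lemma johnson_adj_sym : symmetric johnson_adj.
Proof. by move=> A B; rewrite /johnson_adj setIC. Qed.

Lemma johnson_adj_irr : irreflexive johnson_adj.
Proof.
move=> A; apply/negbTE/existsP => -[s /andP[_]].
by rewrite setIid (eqP (valP A)) gtn_eqF.
Qed.

Definition johnson_graph : sgraph := SGraph johnson_adj_sym johnson_adj_irr.

End GeneralizedJohnson.

(* Main.v *)
(* In G the number of common neighbours of two vertices is a nondecreasing
   function f of the size of their intersection.  Put K = {1, ..., k-1}; its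
   complement has 2q points, q = k - m.  For x outside K and a k-set v not
   containing K, the common neighbours of x + K and v are the k-sets u with
   |u :&: v| <= m and either |u :&: K| < m, or |u :&: K| = m and x \notin u;
   switching turns the last condition into x \in u.  The number of common
   neighbours of x + K and v in CM is then compared with f by means of the
   involution that complements u outside K.
   - If q > 2, let v have k-2 points in K and two outside, y and z.  Averaging
     gives x \notin v such that the number lies strictly between f(k-2) and
     f(k-1), so it is not a value of f.
   - If q = 2, let v have k-3 points in K and all but one point x outside K.
     Then x + K and v are adjacent in CM, with more than f(m) common neighbours,
     the maximum over adjacent pairs of G. *)
Require Import Defs.
From mathcomp Require Import all_boot.
From mathcomp Require Import fingroup perm zify.

Set Implicit Arguments.
Unset Strict Implicit.
Unset Printing Implicit Defensive.

(** * Subsets of prescribed size *)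

Lemma exists_subset_card (T : finType) (A : {set T}) (d : nat) :
  d <= #|A| -> exists2 B : {set T}, B \subset A & #|B| = d.
Proof.
move=> dA; exists [set x in take d (enum A)].
  by apply/subsetP => x; rewrite inE => /mem_take; rewrite mem_enum.
rewrite cardsE; have /card_uniqP -> := take_uniq d (enum_uniq A).
by rewrite size_takel // -cardE.
Qed.

Lemma card_setDS (T : finType) (A B : {set T}) :
  #|A| < #|B| -> exists2 x, x \in B & x \notin A.
Proof.
move=> AB; have /subsetPn[x xB xA] : ~~ (B \subset A); last by exists x.
by apply: contraL AB => /subset_leq_card; rewrite -leqNgt.
Qed.

(** * Monotonicity of the number of common neighbours in the intersection size *)

Section NearDisjoint.
Variables (T : finType) (k m : nat).
Implicit Types (u A B : {set T}) (p : {perm T}).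

Definition near_disjoint A B : {set {set T}} :=
  [set u : {set T} | [&& #|u| == k, #|u :&: A| <= m & #|u :&: B| <= m]].

Lemma card_imset_permI p u A : #|p @: u :&: A| = #|u :&: p @^-1: A|.
Proof.
rewrite -(card_imset (mem (u :&: p @^-1: A)) (@perm_inj _ p)).
congr (#|pred_of_set _|).
apply/setP => y; apply/setIP/imsetP => [[/imsetP[x xu ->] yA]|[x]].
  by exists x => //; rewrite !inE xu.
by rewrite !inE => /andP[xu pxA] ->; rewrite imset_f.
Qed.

Lemma near_disjoint_perm p A B :
  #|near_disjoint (p @^-1: A) (p @^-1: B)| <= #|near_disjoint A B|.
Proof.
have pinj := imset_inj (@perm_inj _ p).
rewrite -(card_imset _ pinj).
apply/subset_leq_card/subsetP => _ /imsetP[u + ->].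
by rewrite !inE !card_imset_permI card_imset //; apply: perm_inj.
Qed.

(** Exchanging [b] for [a] in [B] enlarges its intersection with [A] by one point. The transposition
    of [a] and [b] maps the sets lost from the family injectively to sets gained by it. *)
Lemma near_disjoint_swap A B a b :
  a \in A -> b \notin A -> a \notin B -> b \in B ->
  #|near_disjoint A B| <= #|near_disjoint A (a |: B :\ b)|.
Proof.
move=> aA bA aB bB; set B' := a |: _.
have ab : a != b by apply: contraNneq bA => <-.
set p := tperm a b.
have pB : p @^-1: B = B'.
  apply/setP => i; rewrite !inE; case: tpermP => [->|->|]; rewrite ?bB ?eqxx //=.
    by rewrite (negPf aB) (eq_sym b) (negPf ab).
  by move=> /eqP/negPf-> /eqP/negPf->.
have pB' : p @^-1: B' = B.
  by rewrite -pB; apply/setP => i; rewrite !inE tpermK.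
(* Sets in both families cancel; only the lost ones have to be mapped. *)
rewrite -(cardsID (near_disjoint A B') (near_disjoint A B)).
rewrite -[X in _ <= X](cardsID (near_disjoint A B) (near_disjoint A B')) setIC leq_add2l.
rewrite -(card_imset _ (imset_inj (@perm_inj _ p))).
apply/subset_leq_card/subsetP => _ /imsetP[u + ->].
rewrite !inE !card_imset_permI card_imset; last exact: perm_inj.
rewrite pB pB' => /andP[+ /and3P[uk uA uB]]; rewrite uk uA uB /= -ltnNge => uB'.
rewrite [#|u :&: B'| <= m]leqNgt uB' /= andbF andbT -card_imset_permI.
apply: leq_trans uA.
(* A lost [u] meets [B'] in more points than [B], which forces [a] into [u] and [b] out of it. Its
   image therefore has [b] in place of [a], and since [b] is not in [A], it meets [A] only in points
   of [u]. *)
have {uB uB'} lt : #|u :&: B| < #|u :&: B'| by apply: leq_ltn_trans uB'.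
have au : a \in u.
  apply: contraLR lt => au; rewrite -leqNgt; apply/subset_leq_card/subsetP => i.
  rewrite !inE => /andP[iu /predU1P[E|/andP[_ ->]]]; last by rewrite iu.
  by rewrite -E iu in au.
have bu : b \notin u.
  apply: contraL lt => bu; rewrite -leqNgt -pB -card_imset_permI.
  have -> // : p @: u = u; apply/setP => i; apply/imsetP/idP => [[j ju ->]|iu].
    by case: tpermP => // ->.
  by exists (p i); rewrite ?tpermK //; case: tpermP => // ->.
apply/subset_leq_card/subsetP => _ /setIP[/imsetP[i iu ->]].
case: tpermP; first by rewrite (negPf bA).
  by move=> E; rewrite -E iu in bu.
by rewrite inE iu.
Qed.

End NearDisjoint.

(** The three cardinalities determine the sizes of all four regions of the Venn diagram, so the
    regions can be matched bijectively. *)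
Lemma perm_of_cards n (A B A' B' : {set 'I_n}) :
  #|A'| = #|A| -> #|B'| = #|B| -> #|A' :&: B'| = #|A :&: B| ->
  exists p : {perm 'I_n}, A' = p @^-1: A /\ B' = p @^-1: B.
Proof.
move=> cA cB cAB.
(* A pair of sets is encoded by the tuple of membership types of the points; a rearrangement of this
   tuple is a permutation of the ground set. *)
pose c (X Y : {set 'I_n}) := [tuple (i \in X, i \in Y) | i < n].
have cnt X Y (b : bool * bool) :
    count_mem b (c X Y) = #|[set i | (i \in X, i \in Y) == b]|.
  by rewrite count_map cardsE cardE /enum_mem size_filter -enumT; apply: eq_count.
have cD (X Y : {set 'I_n}) : #|X| = #|X :&: Y| + #|[set i | (i \in X) && (i \notin Y)]|.
  rewrite -(cardsID Y X); congr (_ + #|pred_of_set _|).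
  by apply/setP => i; rewrite !inE andbC.
have : perm_eq (c A' B') (c A B).
  apply/allP => b _; rewrite /= !cnt.
  have e11 (X Y : {set 'I_n}) :
      #|[set i | (i \in X, i \in Y) == (true, true)]| = #|X :&: Y|.
    by apply: eq_card => i; rewrite !inE; case: (i \in X); case: (i \in Y).
  have e10 (X Y : {set 'I_n}) :
      #|[set i | (i \in X, i \in Y) == (true, false)]| = #|X| - #|X :&: Y|.
    rewrite (cD X Y) addKn; apply: eq_card => i.
    by rewrite !inE; case: (i \in X); case: (i \in Y).
  have e01 (X Y : {set 'I_n}) :
      #|[set i | (i \in X, i \in Y) == (false, true)]| = #|Y| - #|X :&: Y|.
    rewrite setIC (cD Y X) addKn; apply: eq_card => i.
    by rewrite !inE; case: (i \in X); case: (i \in Y).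
  have e00 (X Y : {set 'I_n}) :
      #|[set i | (i \in X, i \in Y) == (false, false)]|
      = n - (#|X| + #|Y| - #|X :&: Y|).
    rewrite -cardsU -[X in X - _]card_ord -(cardsC (X :|: Y)) addKn.
    by apply: eq_card => i; rewrite !inE; case: (i \in X); case: (i \in Y).
  by case: b => [[] []]; rewrite ?(e11, e10, e01, e00) ?cA ?cB cAB.
case/tuple_permP => p pE; exists p.
have E i : (i \in A', i \in B') = (p i \in A, p i \in B).
  by move/val_inj: pE => /(congr1 (fun t => tnth t i)); rewrite !tnth_mktuple.
by split; apply/setP => i; rewrite inE; case: (E i).
Qed.

(** Induction on the gap between the two intersection sizes: pairs with equal sizes differ by a
    permutation, and each exchange of one point closes the gap by one. *)
Lemma near_disjoint_mono n k m (A B A' B' : {set 'I_n}) :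
  #|A| = k -> #|B| = k -> #|A'| = k -> #|B'| = k ->
  #|A' :&: B'| <= #|A :&: B| ->
  #|near_disjoint k m A' B'| <= #|near_disjoint k m A B|.
Proof.
move=> cA cB cA' + /subnKC; move: (_ - _) => d.
elim: d B' => [|d IH] B' cB' E.
  have [] := @perm_of_cards _ A B A' B'; rewrite ?cA ?cB -?E ?addn0 //.
  by move=> p [-> ->]; apply: near_disjoint_perm.
have lt : #|A' :&: B'| < k.
  have : #|A :&: B| <= k by rewrite -cA subset_leq_card // subsetIl.
  lia.
have [a aA] : exists2 a, a \in A' & a \notin A' :&: B' by apply: card_setDS; rewrite cA'.
have [b bB] : exists2 b, b \in B' & b \notin A' :&: B' by apply: card_setDS; rewrite cB'.
rewrite !inE aA bB andbT /= => bA aB.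
apply: leq_trans (near_disjoint_swap k m aA bA aB bB) (IH _ _ _).
  by rewrite cardsU1 !inE negb_and aB orbT -cB' [in RHS](cardsD1 b) bB.
have -> : A' :&: (a |: B' :\ b) = a |: (A' :&: B').
  apply/setP => i; rewrite !inE; have [->|_] := eqVneq i a; first by rewrite aA.
  by have [->|] := eqVneq i b; rewrite //= (negPf bA).
by rewrite cardsU1 !inE negb_and aB orbT; lia.
Qed.

(** * The sets affected by switching, and complementation outside [K] *)

Section Layer.
Variables (T : finType) (K : {set T}) (k m q : nat).
Hypotheses (cKC : #|~: K| = q.*2) (kE : k = m + q).
Implicit Types (u v : {set T}) (x y : T).

(** For these [u], adjacency to [x |: K] depends on whether [x] lies in [u]. Each has [q] points
    outside [K], exactly half of the complement, so [flip] preserves its size. *)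
Definition layer v : {set {set T}} :=
  [set u : {set T} | [&& #|u| == k, #|u :&: v| <= m & #|u :&: K| == m]].

Definition flip u : {set T} := (u :&: K) :|: ~: (u :|: K).

Lemma in_flip u x : (x \in flip u) = (x \in u) (+) (x \notin K).
Proof. by rewrite !inE; case: (x \in u); case: (x \in K). Qed.

Lemma flipK : involutive flip.
Proof. by move=> u; apply/setP => x; rewrite !in_flip addbK. Qed.

Lemma card_layerD u v : u \in layer v -> #|u :\: K| = q.
Proof.
rewrite inE => /and3P[/eqP uk _ /eqP uK].
by apply: (@addnI m); rewrite -kE -uk -(cardsID K u) uK.
Qed.

(** Outside [K], flipping replaces the part of [v] inside [u] by the part of [v] missed by [u]; this
    does not enlarge the intersection if [u] holds at least half of [v :\: K]. *)
Lemma flip_layer u v : u \in layer v ->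
  #|v :\: K| <= #|(u :&: v) :\: K|.*2 -> flip u \in layer v.
Proof.
move=> uF le; have uD := card_layerD uF; move: uF.
rewrite !inE => /and3P[/eqP uk uv /eqP uK].
have fK : flip u :&: K = u :&: K.
  by apply/setP => x; rewrite !inE; case: (x \in u); case: (x \in K).
have fD : flip u :\: K = ~: K :\: (u :\: K).
  by apply/setP => x; rewrite !inE; case: (x \in u); case: (x \in K).
have fvK : flip u :&: v :&: K = u :&: v :&: K.
  by apply/setP => x; rewrite !inE; case: (x \in u); case: (x \in K); case: (x \in v).
have fvD : (flip u :&: v) :\: K = (v :\: K) :\: ((u :&: v) :\: K).
  by apply/setP => x; rewrite !inE; case: (x \in u); case: (x \in K); case: (x \in v).
have cD : #|~: K :\: (u :\: K)| = q.
  rewrite cardsD cKC (setIidPr _) ?uD.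
    by rewrite -addnn addKn.
  by rewrite setDE subsetIr.
have cvD : #|(v :\: K) :\: ((u :&: v) :\: K)| = #|v :\: K| - #|(u :&: v) :\: K|.
  by rewrite cardsD (setIidPr _) // setSD // subsetIr.
rewrite fK uK eqxx andbT -(cardsID K (flip u)) fK fD cD uK -kE eqxx /=.
rewrite -(cardsID K (_ :&: v)) fvK fvD cvD.
by move: uv; rewrite -(cardsID K (_ :&: v)); lia.
Qed.

(** The sum is the size of [flip u :&: v], split along [K]. *)
Lemma flip_notin_layer u v :
  m < #|u :&: v :&: K| + #|v :\: (K :|: u)| -> flip u \notin layer v.
Proof.
apply: contraL; rewrite inE -leqNgt => /and3P[_ + _].
rewrite -(cardsID K (_ :&: v)); congr (_ + _ <= m); apply: eq_card => x;
  by rewrite !inE; case: (x \in u); case: (x \in K); case: (x \in v).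
Qed.

Definition layer_in v x : nat := #|[set u in layer v | x \in u]|.
Definition layer_out v x : nat := #|[set u in layer v | x \notin u]|.

(** This splitting and the next share the term with [x] in [u] and [y] outside [u], which cancels
    when the two counts are compared. *)
Lemma layer_inE v x y : layer_in v x =
  #|[set u in layer v | (x \in u) && (y \in u)]|
  + #|[set u in layer v | (x \in u) && (y \notin u)]|.
Proof.
rewrite /layer_in -(cardsID [set u : {set T} | y \in u]).
by congr (_ + _); apply: eq_card => u; rewrite !inE; case: (x \in u); case: (y \in u);
  rewrite ?andbF ?andbT.
Qed.

Lemma layer_outE v x y : layer_out v y =
  #|[set u in layer v | (x \notin u) && (y \notin u)]|
  + #|[set u in layer v | (x \in u) && (y \notin u)]|.
Proof.
rewrite /layer_out addnC -(cardsID [set u : {set T} | x \in u]).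
by congr (_ + _); apply: eq_card => u; rewrite !inE; case: (x \in u); case: (y \in u);
  rewrite ?andbF ?andbT.
Qed.

(** After cancellation, the sets containing both [x] and [y] are compared with those containing
    neither. [flip] injects the former into the latter and misses [u0]. *)
Lemma layer_in_lt_out v x y u0 :
  x \notin K -> y \notin K ->
  (forall u, u \in layer v -> x \in u -> y \in u -> flip u \in layer v) ->
  u0 \in layer v -> x \notin u0 -> y \notin u0 -> flip u0 \notin layer v ->
  layer_in v x < layer_out v y.
Proof.
move=> xK yK fl u0F xu0 yu0 fu0; rewrite (layer_inE _ _ y) (layer_outE _ x) ltn_add2r.
rewrite -(card_imset _ (inv_inj flipK)); apply: proper_card; apply/properP; split.
  apply/subsetP => _ /imsetP[u + ->].
  rewrite ![_ \in [set _ in _ | _]]inE !in_flip xK yK !addbT !negbK.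
  by case/and3P => uF xu yu; rewrite xu yu fl.
exists u0; first by rewrite inE u0F xu0 yu0.
apply: contra fu0 => /imsetP[u + ->]; rewrite flipK.
by rewrite inE => /andP[].
Qed.

Lemma layer_out_lt_in v x y u0 :
  x \notin K -> y \notin K ->
  (forall u, u \in layer v -> x \notin u -> y \notin u -> flip u \in layer v) ->
  u0 \in layer v -> x \in u0 -> y \in u0 -> flip u0 \notin layer v ->
  layer_out v y < layer_in v x.
Proof.
move=> xK yK fl u0F xu0 yu0 fu0; rewrite (layer_inE _ _ y) (layer_outE _ x) ltn_add2r.
rewrite -(card_imset _ (inv_inj flipK)); apply: proper_card; apply/properP; split.
  apply/subsetP => _ /imsetP[u + ->].
  rewrite ![_ \in [set _ in _ | _]]inE !in_flip xK yK !addbT.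
  by case/and3P => uF xu yu; rewrite xu yu fl.
exists u0; first by rewrite inE u0F xu0 yu0.
apply: contra fu0 => /imsetP[u + ->]; rewrite flipK.
by rewrite inE => /andP[].
Qed.

Lemma exists_layer (P Q v : {set T}) :
  P \subset K -> #|P| = m -> Q \subset ~: K -> #|Q| = q ->
  #|P :&: v| + #|Q :&: v| <= m -> P :|: Q \in layer v.
Proof.
move=> PK cP QK cQ le.
have QK0 : Q :&: K = set0 by apply/eqP; rewrite setI_eq0 disjoints_subset.
have PQ : P :&: Q = set0.
  by apply/eqP; rewrite -subset0 -QK0 setIC setIS.
rewrite inE cardsU PQ cards0 subn0 cP cQ -kE eqxx /=.
have -> : (P :|: Q) :&: K = P.
  by rewrite setIUl (setIidPl PK) QK0 setU0.
rewrite cP eqxx andbT setIUl cardsU.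
by apply: leq_trans le; rewrite leq_subr.
Qed.

Hypothesis cK : #|K|.+1 = k.

(* Averaging over [x]: [#|X :&: u| - #|X :\: u| = #|v :\: K| - 2 #|u :&: v :\: K|]
   is nonnegative on the layer. *)
Lemma exists_layer_out_lt_in v :
  2 < q -> #|v :\: K| = 2 -> #|K :\: v| = 1 ->
  exists2 x, x \notin K :|: v & layer_out v x < layer_in v x.
Proof.
move=> q3 cvD cKD; set X := ~: (K :|: v).
have cX : #|X| = q.*2 - 2.
  by rewrite -cvD -cKC -(cardsID v (~: K)) setIC -setDE addKn /X setCU setDE.
(* All but at most one of the [m] points of [u :&: K] lie in [v], which leaves room for at most one
   point of [u :&: v] outside [K]. *)
have small u : u \in layer v -> #|(u :&: v) :\: K| <= 1.
  rewrite inE => /and3P[_ uv /eqP uK].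
  have : #|u :&: K| <= #|u :&: v :&: K| + #|K :\: v|.
    rewrite -(cardsID v (u :&: K)) leq_add //.
      by rewrite setIAC.
    by rewrite subset_leq_card // setSD // subsetIr.
  by move: uv; rewrite -(cardsID K (u :&: v)); lia.
have XI u : u \in layer v -> #|X :&: u| = q - #|(u :&: v) :\: K|.
  move=> uF; rewrite -(card_layerD uF) -(cardsID v (u :\: K)).
  rewrite setIDAC addKn; apply: eq_card => x; rewrite !inE.
  by case: (x \in u); case: (x \in K); case: (x \in v).
have sum (p : T -> {set T} -> bool) : \sum_(x in X) #|[set u in layer v | p x u]|
    = \sum_(u in layer v) #|[set x in X | p x u]|.
  have E (U : finType) (A : {set U}) (r : pred U) :
      #|[set i in A | r i]| = \sum_(i in A) r i.
    rewrite -sum1_card big_mkcond [RHS]big_mkcond.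
    by apply: eq_bigr => i _; rewrite inE; case: (i \in A).
  under eq_bigr do rewrite E; rewrite exchange_big /=.
  by apply: eq_bigr => u _; rewrite E.
suff : \sum_(x in X) layer_out v x < \sum_(x in X) layer_in v x.
  move=> lt; have [x xX xlt] : exists2 x, x \in X & layer_out v x < layer_in v x.
    apply/exists_inP; apply: contraLR lt; rewrite negb_exists_in -leqNgt => /forall_inP H.
    by apply: leq_sum => x xX; rewrite leqNgt H.
  by exists x => //; move: xX; rewrite inE.
rewrite /layer_out /layer_in (sum (fun x u => x \notin u)) (sum (fun x u => x \in u)).
have [P PK cP] : exists2 P : {set T}, P \subset K & #|P| = m.
  by apply: exists_subset_card; lia.
(* [X] has [2q - 2] points, at least [q]. The member [P :|: Q] avoids [v] outside [K], so its
   contribution is [q] against [q - 2], which makes the sum inequality strict. *)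
have [Q QX cQ] : exists2 Q : {set T}, Q \subset X & #|Q| = q.
  by apply: exists_subset_card; lia.
have QK : Q \subset ~: K by apply: subset_trans QX _; rewrite setCS subsetUl.
have Qv : Q :&: v = set0.
  by apply/eqP; rewrite setI_eq0 disjoints_subset (subset_trans QX) // setCS subsetUr.
have u0F : P :|: Q \in layer v.
  apply: exists_layer => //; rewrite Qv cards0 addn0 -cP.
  by rewrite subset_leq_card // subsetIl.
have outin u : #|[set x in X | x \notin u]| = #|X| - #|[set x in X | x \in u]|.
  rewrite (_ : [set x in X | x \in u] = X :&: u); last by apply/setP => x; rewrite !inE.
  by rewrite -cardsD; apply: eq_card => x; rewrite !inE andbC.
have inE' u : u \in layer v -> #|[set x in X | x \in u]| = q - #|(u :&: v) :\: K|.
  by move/XI <-; apply: eq_card => x; rewrite !inE.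
rewrite (bigD1 _ u0F) [X in _ < X](bigD1 _ u0F) /= -addSn leq_add //.
  rewrite outin cX inE' //.
  have -> : (P :|: Q) :&: v :\: K = set0.
    apply/setP => x; rewrite !inE; apply/negP => /and3P[xK /orP[xP|xQ] xv].
      by rewrite (subsetP PK) in xK.
    by have := in_set0 x; rewrite -Qv inE xQ xv.
  rewrite cards0; lia.
apply: leq_sum => u /andP[uF _]; rewrite outin cX inE' //.
have := small u uF; lia.
Qed.

End Layer.

(** * Common neighbours as an isomorphism invariant *)

Definition common_nbrs (G : sgraph) (u v : G) : nat :=
  #|[set w | adj u w && adj v w]|.

Lemma isomorphic_common_nbrs (G H : sgraph) : isomorphic G H ->
  forall u v : H, exists u' v' : G,
    adj u' v' = adj u v /\ common_nbrs u' v' = common_nbrs u v.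
Proof.
case=> f [g fK gK] fadj u v; exists (g u), (g v); split; first by rewrite -fadj !gK.
rewrite /common_nbrs -(card_imset _ (can_inj fK)); apply: eq_card => w.
rewrite [RHS]inE; apply/imsetP/andP => [[w' + ->]|[uw vw]].
  by rewrite inE -!fadj !gK => /andP.
by exists (g w); rewrite ?gK // inE -!fadj !gK uw.
Qed.

(** * The generalized Johnson graph, the switching set and the switched graph *)

Section Johnson.
Variables (n k m : nat).
Hypothesis mk : m < k.

Let S := [set s : 'I_k | s <= m].
Let G := johnson_graph n S.
Implicit Types A B : ksubset n k.

Lemma johnson_leE A B : @adj G A B = (#|val A :&: val B| <= m).
Proof.
apply/existsP/idP => [[s /andP[+ /eqP->]]|le]; first by rewrite inE.
by exists (Ordinal (leq_ltn_trans le mk)); rewrite inE /= le eqxx.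
Qed.

Lemma card_ksubset (p : pred {set 'I_n}) :
  #|[set A : ksubset n k | p (val A)]| = #|[set u : {set 'I_n} | (#|u| == k) && p u]|.
Proof.
rewrite -(card_imset _ val_inj); apply: eq_card => u; rewrite [RHS]inE.
apply/imsetP/andP => [[A + ->]|[uk pu]].
  by rewrite inE => pA; split=> //; apply: (valP A).
by exists (Sub u uk); rewrite ?inE.
Qed.

Lemma common_nbrs_johnson A B :
  @common_nbrs G A B = #|near_disjoint k m (val A) (val B)|.
Proof.
rewrite /common_nbrs /near_disjoint -(card_ksubset (fun u => _ && _)).
by apply: eq_card => C; rewrite !inE !johnson_leE ![_ :&: val C]setIC.
Qed.

Variables (K : {set 'I_n}) (q : nat).
Hypotheses (cK : #|K|.+1 = k) (cKC : #|~: K| = q.*2) (kE : k = m + q) (q2 : 1 < q).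

Let C := [set A : G | K \subset val (A : ksubset n k)].

Lemma mem_C A : (A \in C) = (#|val A :&: K| == k.-1).
Proof.
rewrite inE; apply/setIidPr/eqP => [->|E]; first by rewrite -cK.
by apply/eqP; rewrite eqEcard subsetIr /= E -cK.
Qed.

(** Two members share [K], whose [k - 1 = m + q - 1] points exceed [m] because [q > 1]. *)
Lemma adj_C A B : A \in C -> B \in C -> @adj G A B = false.
Proof.
rewrite !inE johnson_leE => KA KB; apply/negbTE; rewrite -ltnNge.
have : #|K| <= #|val A :&: val B| by rewrite subset_leq_card // subsetI KA.
lia.
Qed.

(** The map from [x] to [x |: K] is a bijection from the complement of [K] onto the switching
    set. *)
Lemma card_sub_C (p : pred {set 'I_n}) :
  #|[set A in C | p (val A)]| = #|[set x in ~: K | p (x |: K)]|.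
Proof.
have inj : {in [set x in ~: K | p (x |: K)] &, injective (fun x => x |: K)}.
  move=> x y; rewrite !inE => /andP[xK _] /andP[yK _] /setP /(_ x).
  by rewrite !inE eqxx (negPf xK) !orbF => /esym/eqP.
rewrite -(card_in_imset inj) -(card_imset _ val_inj); apply: eq_card => u.
apply/imsetP/imsetP => [[A + ->]|[x + ->]].
  rewrite !inE => /andP[KA pA].
  have : #|val A :\: K| = 1.
    by rewrite cardsD (setIidPr KA) (eqP (valP A)) -cK subSnn.
  move/eqP/cards1P => [x xE].
  have AE : val A = x |: K.
    by rewrite -(setID (val A) K) xE (setIidPr KA) setUC.
  exists x => //; rewrite !inE -AE pA andbT.
  by have := set11 x; rewrite -xE inE => /andP[].
rewrite !inE => /andP[xK px].
have ck : #|x |: K| == k by rewrite cardsU1 xK -cK.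
by exists (Sub (x |: K) ck); rewrite ?SubK // !inE SubK subsetUr.
Qed.

Lemma card_C : #|C| = q.*2.
Proof.
rewrite -cKC; have := card_sub_C predT; rewrite (_ : [set x in _ | _] = ~: K).
  by move=> <-; apply: eq_card => A; rewrite !inE andbT.
by apply/setP => x; rewrite !inE andbT.
Qed.

Lemma card_setI_addK (u : {set 'I_n}) x : x \notin K ->
  #|u :&: (x |: K)| = #|u :&: K| + (x \in u).
Proof.
move=> xK; rewrite setIUr.
have [xu|xu] := boolP (x \in u).
  by rewrite (setIidPr _) ?sub1set // cardsU1 inE (negPf xK) andbF addnC.
rewrite (_ : u :&: [set x] = set0) ?set0U ?addn0 //.
by apply/setP => y; rewrite !inE; apply: contraNF xu => /andP[? /eqP<-].
Qed.

(** [A] meets [x |: K] in [#|A :&: K|] points, plus one if [x] is in [A]. In the middle case the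
    neighbours come from the [x] outside both [K] and [A]; [A] has [k - m = q] of the [2q] points
    outside [K], so [q] remain. *)
Lemma card_nbrs_in_C A : #|nbrs_in C A| =
  if #|val A :&: K| < m then q.*2 else if #|val A :&: K| == m then q else 0.
Proof.
have -> : nbrs_in C A = [set B in C | #|val A :&: val B| <= m].
  by apply/setP => B; rewrite !inE johnson_leE.
rewrite (card_sub_C (fun u => #|val A :&: u| <= m)).
case: ltngtP => [lt|lt|E].
- rewrite -cKC; apply: eq_card => x; rewrite !inE.
  by have [//|xK] := boolP (x \in K); rewrite card_setI_addK //; case: (x \in _); lia.
- apply/eqP; rewrite cards_eq0; apply/eqP/setP => x; rewrite !inE.
  by have [//|xK] := boolP (x \in K); rewrite card_setI_addK //; case: (x \in _); lia.
have <- : #|~: K :\: (val A :\: K)| = q.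
  rewrite cardsD cKC (setIidPr _); last by rewrite setDE subsetIr.
  by rewrite cardsD (eqP (valP A)) E kE addKn -addnn addnK.
apply: eq_card => x; rewrite !inE.
have [|xK] := boolP (x \in K); first by rewrite andbF.
by rewrite card_setI_addK // E; case: (x \in val A); lia.
Qed.

Lemma switching_set_C : switching_set C.
Proof.
split=> [A B CA CB|A CA].
  rewrite !card_nbrs_in_C; move: CA CB; rewrite !mem_C => /eqP-> /eqP->.
  by [].
rewrite card_nbrs_in_C card_C.
by case: ltngtP => _; [constructor 3|constructor 1|constructor 2].
Qed.

Lemma toggledE A B : toggled C A B =
  [&& A \notin C, B \in C & #|val A :&: K| == m].
Proof.
rewrite /toggled card_nbrs_in_C card_C; congr [&& _, _ & _].
by case: ltngtP => _; apply/eqP; lia.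
Qed.

Let CM := GM_switch C.

Lemma adj_CM_out A B : A \notin C -> B \notin C ->
  @adj CM A B = (#|val A :&: val B| <= m).
Proof.
move=> CA CB; rewrite /= /switch_adj !toggledE (negPf CB) (negPf CA) !andbF.
by rewrite addbF johnson_leE.
Qed.

Lemma adj_CM_C A B x : x \notin K -> val A = x |: K -> @adj CM A B =
  (#|val B :&: K| < m) || (#|val B :&: K| == m) && (x \in val B).
Proof.
move=> xK AE; have CA : A \in C by rewrite inE AE subsetUr.
rewrite /= /switch_adj !toggledE CA.
have [CB|CB] := boolP (B \in C).
  rewrite adj_C //; move: CB; rewrite mem_C => /eqP->.
  by apply/esym/negbTE; case: (x \in _); lia.
rewrite johnson_leE AE setIC card_setI_addK //.
move: #|_ :&: K| => c /=.
by case: (x \in val B); case: ltngtP => /=; rewrite ?addbF ?addbT; lia.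
Qed.

(* The common neighbours of [x |: K] and [v] that switching does not affect. *)
Let far (v : {set 'I_n}) := #|[set u : {set 'I_n} |
  [&& #|u| == k, #|u :&: v| <= m & #|u :&: K| < m]]|.

Lemma near_disjoint_layer v x : x \notin K ->
  #|near_disjoint k m (x |: K) v| = far v + layer_out K k m v x.
Proof.
move=> xK; rewrite /near_disjoint /far /layer_out.
rewrite -[LHS](cardsID [set u : {set 'I_n} | #|u :&: K| < m]).
congr (_ + _); apply: eq_card => u; rewrite !inE card_setI_addK //;
  move: #|u :&: K| (_ == k) (#|u :&: v| <= m) (x \in u) => c [] [] [];
  by case: ltngtP => /=; lia.
Qed.

Lemma common_nbrs_CM A B x : x \notin K -> val A = x |: K -> B \notin C ->
  @common_nbrs CM A B = far (val B) + layer_in K k m (val B) x.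
Proof.
move=> xK AE CB; have CA : A \in C by rewrite inE AE subsetUr.
transitivity #|[set D : ksubset n k | (#|val D :&: val B| <= m) &&
    ((#|val D :&: K| < m) || (#|val D :&: K| == m) && (x \in val D))]|.
  rewrite /common_nbrs; apply: eq_card => D; rewrite inE [RHS]inE.
  (* A vertex [D] of the switching set counts on neither side, as it meets [K] in [k - 1 > m]
     points. *)
  rewrite (adj_CM_C _ xK AE) andbC; have [CD|CD] := boolP (D \in C).
    move: CD; rewrite mem_C => /eqP->.
    rewrite (_ : (_ < m) || _ = false) ?andbF //; apply/negbTE; case: (x \in _); lia.
  by rewrite adj_CM_out // setIC.
rewrite (card_ksubset (fun u => (#|u :&: val B| <= m) &&
  ((#|u :&: K| < m) || (#|u :&: K| == m) && (x \in u)))) /far /layer_in.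
rewrite -[LHS](cardsID [set u : {set 'I_n} | #|u :&: K| < m]).
congr (_ + _); apply: eq_card => u; rewrite !inE;
  move: #|u :&: K| (_ == k) (#|u :&: val B| <= m) (x \in u) => c [] [] [];
  by case: ltngtP.
Qed.

(** * Non-isomorphism in the cases [q > 2] and [q = 2] *)

Lemma not_isomorphic_q_gt2 : 2 < q -> ~ isomorphic G CM.
Proof.
move=> q3 /isomorphic_common_nbrs iso.
have mk2 : m < k - 2 by lia.
have kS : k - 2 < k.-1 by lia.
have [a aK] : exists a, a \in K by apply/card_gt0P; lia.
have [y [z [yK zK yz]]] : exists y z, [/\ y \in ~: K, z \in ~: K & y != z].
  by apply/card_gt1P; lia.
move: yK zK; rewrite !inE => yK zK.
pose v := [set y; z] :|: K :\ a.
have vI : v :&: K = K :\ a.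
  apply/setP => i; rewrite !inE; case: (boolP (i \in K)) => iK; rewrite ?andbF // !andbT.
  have [iy|_] := eqVneq i y; first by rewrite -iy iK in yK.
  by have [iz|_] := eqVneq i z; first by rewrite -iz iK in zK.
have vD : v :\: K = [set y; z].
  apply/setP => i; rewrite !inE; case: (boolP (i \in K)) => iK; rewrite ?andbF ?orbF //=.
  have [iy|_] := eqVneq i y; first by rewrite -iy iK in yK.
  by have [iz|_] := eqVneq i z; first by rewrite -iz iK in zK.
have cKa : #|K :\ a| = k - 2 by move: (cardsD1 a K); rewrite aK; lia.
have cvD : #|v :\: K| = 2 by rewrite vD cards2 yz.
have cKD : #|K :\: v| = 1.
  by move: (cardsID v K); rewrite setIC vI cKa; lia.
have cv : #|v| == k.
  by apply/eqP; rewrite -(cardsID K v) vI cvD cKa; lia.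
have yv : y \in v by rewrite !inE eqxx.
have [x xKv out_in] := exists_layer_out_lt_in cKC kE cK q3 cvD cKD.
move: (xKv); rewrite inE negb_or => /andP[xK xv].
(* Any [u] containing [y] holds at least half of [v :\: K], so its flip stays in the layer. The set
   [P :|: Q] is the witness for strictness: its flip meets [v] in [P], [y] and [z], that is, in
   [m + 2] points. *)
have in_out : layer_in K k m v x < layer_out K k m v y.
  have [P PK cP] : exists2 P : {set 'I_n}, P \subset K :\ a & #|P| = m.
    by apply: exists_subset_card; rewrite cKa ltnW.
  have [Q QX cQ] : exists2 Q : {set 'I_n}, Q \subset ~: (x |: (K :|: v)) & #|Q| = q.
    apply: exists_subset_card.
    (* There are [2q - 3] points outside [K], [v] and [x]; this is at least [q] since [q > 2]. *)
    rewrite -(leq_add2l 3) (_ : 3 + #|_| = q.*2) -?addnn ?leq_add2r //.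
    rewrite addnn -cKC -[RHS](cardsID (v :|: [set x])).
    have -> : ~: K :\: (v :|: [set x]) = ~: (x |: (K :|: v)).
      by rewrite setDE -setCU setUA setUC.
    have -> : ~: K :&: (v :|: [set x]) = x |: (v :\: K).
      apply/setP => i; rewrite !inE; have [->|_] := eqVneq i x; first by rewrite xK orbT.
      by rewrite orbF.
    by rewrite cardsU1 cvD inE (negPf xv) andbF.
  have notQ i : i \in x |: (K :|: v) -> i \notin Q.
    by apply: contraL => /(subsetP QX); rewrite inE.
  have notP i : i \notin K -> i \notin P.
    by apply: contraNN => /(subsetP PK); rewrite inE => /andP[].
  have xQ : x \notin Q by apply: notQ; rewrite setU11.
  have yQ : y \notin Q by apply: notQ; rewrite in_setU1 in_setU yv !orbT.
  have zQ : z \notin Q by apply: notQ; rewrite in_setU1 in_setU !inE eqxx !orbT.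
  apply: (@layer_in_lt_out _ K k m v x y (P :|: Q)) => //.
  - move=> u uF xu yu; apply: (flip_layer cKC kE) => //.
    rewrite cvD (_ : 2 = 1.*2) // leq_double.
    by apply/card_gt0P; exists y; rewrite inE yK inE yu yv.
  - apply: (exists_layer kE) => //.
    + by apply: subset_trans PK _; apply: subD1set.
    + by apply: subset_trans QX _; rewrite setCS subsetU // subsetUl orbT.
    have -> : Q :&: v = set0.
      apply/setP => i; rewrite in_setI in_set0; apply/negP => /andP[+ iv].
      by apply/negP/notQ; rewrite in_setU1 in_setU iv !orbT.
    by rewrite cards0 addn0 -cP subset_leq_card // subsetIl.
  - by rewrite inE negb_or notP.
  - by rewrite inE negb_or notP.
  apply: flip_notin_layer.
  have cPv : #|P| <= #|(P :|: Q) :&: v :&: K|.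
    apply/subset_leq_card; rewrite -setIA vI subsetI subsetUl; exact: PK.
  have cyz : #|[set y; z]| <= #|v :\: (K :|: (P :|: Q))|.
    apply/subset_leq_card/subsetP => i; rewrite !inE => /orP[]/eqP->.
      by rewrite eqxx (negPf yK) (negPf yQ) (negPf (notP _ yK)).
    by rewrite eqxx orbT (negPf zK) (negPf zQ) (negPf (notP _ zK)).
  by apply: leq_trans (leq_add cPv cyz); rewrite cP cards2 yz addn2.
have cU t : t \notin K -> #|t |: K| == k by move=> tK; rewrite cardsU1 tK -cK.
pose A : ksubset n k := Sub (x |: K) (cU x xK).
pose B : ksubset n k := Sub v cv.
have CB : B \notin C by rewrite mem_C SubK vI cKa ltn_eqF.
have [A' [B' [_ cAB]]] := iso A B.
rewrite common_nbrs_johnson (common_nbrs_CM xK (SubK _ _) CB) SubK in cAB.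
have cI t : t \notin K -> #|(t |: K) :&: v| = k - 2 + (t \in v).
  by move=> tK; rewrite setIC card_setI_addK // vI cKa.
(* A pair of [G] meeting in at most [k - 2] points has too few common neighbours, by comparison with
   [x |: K] and [v]; one meeting in at least [k - 1] has too many, by comparison with [y |: K] and
   [v]. *)
have [le|gt] := leqP #|val A' :&: val B'| (k - 2).
  have := near_disjoint_mono m (eqP (cU x xK)) (eqP cv) (eqP (valP A')) (eqP (valP B')).
  rewrite cI // (negPf xv) addn0 near_disjoint_layer // => /(_ le).
  by rewrite cAB leq_add2l leqNgt out_in.
have := near_disjoint_mono m (eqP (valP A')) (eqP (valP B')) (eqP (cU y yK)) (eqP cv).
rewrite cI // yv addn1 => /(_ gt).
by rewrite near_disjoint_layer // cAB leq_add2l leqNgt in_out.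
Qed.

Lemma not_isomorphic_q_eq2 : q = 2 -> 2 < k -> ~ isomorphic G CM.
Proof.
move=> qE k3 /isomorphic_common_nbrs iso.
have mE : k - 3 + 1 = m by lia.
have kmE : k - 3 + 2 = m.+1 by lia.
have kS : k - 3 < k.-1 by lia.
have [a [b [aK bK ab]]] : exists a b, [/\ a \in K, b \in K & a != b].
  by apply/card_gt1P; lia.
have cKb : #|K :\ b| = m by move: cK; rewrite (cardsD1 b K) bK; lia.
have [x [y []]] : exists x y, [/\ x \in ~: K, y \in ~: K & x != y].
  by apply/card_gt1P; lia.
rewrite !inE => xK yK xy.
(* Here [m = k - 2] and the complement of [K] has four points. Thus [v] meets [x |: K] in [m - 1]
   points and [y |: K] in [m]. *)
pose v := (~: K :\ x) :|: (K :\: [set a; b]).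
have vI : v :&: K = K :\: [set a; b].
  by apply/setP => i; rewrite !inE; case: (i \in K); rewrite ?andbF ?andbT.
have vD : v :\: K = ~: K :\ x.
  by apply/setP => i; rewrite !inE; case: (i \in K); rewrite ?andbF ?andbT ?orbF.
have xv : x \notin v by rewrite !inE eqxx (negPf xK) andbF.
have yv : y \in v by rewrite !inE eq_sym xy yK.
have cab : #|K :\: [set a; b]| = k - 3.
  rewrite cardsD (setIidPr _) ?cards2 ?ab; first by rewrite -cK subSS.
  by apply/subsetP => i; rewrite !inE => /orP[]/eqP->.
have cx : #|~: K :\ x| = 3.
  by move: cKC; rewrite (cardsD1 x) inE xK qE => -[].
have cxy : #|~: K :\: [set x; y]| = 2.
  rewrite cardsD (setIidPr _) ?cards2 ?xy; first by rewrite cKC qE.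
  by apply/subsetP => i; rewrite !inE => /orP[]/eqP->.
have cv : #|v| == k.
  by apply/eqP; rewrite -(cardsID K v) vI vD cx cab subnK.
have out_in : layer_out K k m v y < layer_in K k m v x.
  have QK : [set x; y] \subset ~: K.
    by apply/subsetP => i; rewrite !inE => /orP[]/eqP->.
  (* A layer set avoiding [x] has both its outer points among the three of [v :\: K], so flipping
     keeps it in the layer. The witness meets [v] in [k - 3] points of [K] and [y]; its flip has two
     outer points in [v] instead of one, hence meets [v] in [m + 1] points. *)
  apply: (@layer_out_lt_in _ K k m v x y ((K :\ b) :|: [set x; y])) => //.
  - move=> u uF xu yu; apply: (flip_layer cKC kE) => //.
    rewrite vD cx; have uD := card_layerD kE uF.
    have -> : (u :&: v) :\: K = u :\: K; last by rewrite uD qE.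
    apply/setP => i; rewrite !inE.
    have [->|_] := eqVneq i x; first by rewrite (negPf xu) !andbF.
    by case: (i \in K); case: (i \in u).
  - apply: (exists_layer kE) => //.
    + exact: subD1set.
    + by rewrite cards2 xy qE.
    have -> : (K :\ b) :&: v = K :\: [set a; b].
      apply/setP => i; rewrite !inE; case: (i \in K); rewrite ?andbF //= !andbT.
      by case: (i == a); case: (i == b).
    have -> : [set x; y] :&: v = [set y].
      apply/setP => i; rewrite !inE.
      have [->|_] := eqVneq i x; first by rewrite (negPf xy) (negPf xK) !andbF.
      by have [->|] := eqVneq i y; rewrite //= yK.
    by rewrite cab cards1 mE.
  - by rewrite !inE eqxx orbT.
  - by rewrite !inE eqxx !orbT.
  apply: flip_notin_layer.
  have cabv : #|K :\: [set a; b]| <= #|((K :\ b) :|: [set x; y]) :&: v :&: K|.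
    apply/subset_leq_card; rewrite -setIA vI subsetI subxx andbT subsetU //.
    by rewrite setDS // sub1set !inE eqxx orbT.
  have cxyv : #|~: K :\: [set x; y]| <= #|v :\: (K :|: ((K :\ b) :|: [set x; y]))|.
    apply/subset_leq_card/subsetP => i; rewrite !inE.
    by case: (i == x); case: (i == y); case: (i \in K); rewrite ?andbF.
  by apply: leq_trans (leq_add cabv cxyv); rewrite cab cxy kmE.
have cU t : t \notin K -> #|t |: K| == k by move=> tK; rewrite cardsU1 tK -cK.
pose A : ksubset n k := Sub (x |: K) (cU x xK).
pose B : ksubset n k := Sub v cv.
have CB : B \notin C by rewrite mem_C SubK vI cab ltn_eqF.
have [A' [B' [aAB cAB]]] := iso A B.
rewrite common_nbrs_johnson (common_nbrs_CM xK (SubK _ _) CB) SubK in cAB.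
move: aAB; rewrite johnson_leE (adj_CM_C _ xK (SubK _ _)) SubK vI cab -[X in _ < X]mE.
rewrite addn1 leqnn => le.
(* Adjacency in [G] bounds the intersection of [A'] and [B'] by [m], the size attained by [y |: K]
   and [v]. *)
have := near_disjoint_mono m (eqP (cU y yK)) (eqP cv) (eqP (valP A')) (eqP (valP B')).
rewrite [(y |: K) :&: v]setIC card_setI_addK // vI cab yv mE => /(_ le).
by rewrite near_disjoint_layer // cAB leq_add2l leqNgt out_in.
Qed.

End Johnson.

(** * The stated parameters, with [q = k - m] *)

Theorem theorem7 (m k : nat) (hk : maxn (m + 2) 3 <= k) :
  let n := 3 * k - 2 * m - 1 in
  let S := [set s : 'I_k | s <= m] in
  let G := johnson_graph n S in
  let C := [set A : G | [set i : 'I_n | i < k - 1] \subset val (A : ksubset n k)] in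
  let CM := GM_switch C in
  switching_set C /\ ~ isomorphic G CM.
Proof.
move=> n S G C CM.
have mk : m < k by lia.
set K := [set i : 'I_n | i < k - 1] in C CM *.
have kn : k - 1 <= n by rewrite /n; lia.
have cK : #|K|.+1 = k.
  have -> : K = [set widen_ord kn i | i in 'I_(k - 1)].
    apply/setP => i; rewrite inE; apply/idP/imsetP => [ik|[j _ ->] //].
      by exists (Ordinal ik) => //; apply: val_inj.
    exact: (ltn_ord j).
  rewrite card_imset ?card_ord; first by lia.
  by move=> i j /(congr1 val) E; apply: val_inj.
have cKC : #|~: K| = (k - m).*2.
  (* The choice of [n] is exactly [(k - 1) + 2q], so that half of the complement of [K] has [k - m]
     points. *)
  have nE : n.+1 = k + (k - m).*2 by rewrite /n; lia.
  by apply: (@addnI k); rewrite -nE -[in LHS]cK addSn cardsC card_ord.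
have kE : k = m + (k - m) by lia.
have q2 : 1 < k - m by lia.
split; first exact: (switching_set_C mk cK cKC kE).
have [q3|q2'] := ltnP 2 (k - m).
  exact: (not_isomorphic_q_gt2 mk cK cKC kE).
by apply: (not_isomorphic_q_eq2 mk cK cKC kE) => //; lia.
Qed.
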